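(* Let $Z_D=\{\boldsymbol{x}\in\mathbb{R}^n:\inf_{\mathbb{P}\in\mathcal{P}_W}\mathbb{P}\{\boldsymbol{\xi}: f_t(\boldsymbol{x},\boldsymbol{\xi})\ge 0\ \forall t\in[T]\}\ge 1-\epsilon\}$. Then $Z_D$ equals the set of all $\boldsymbol{x}\in\mathbb{R}^n$ for which there exist $\lambda\ge 0$, $s_i\ge 0$ ($i\in[N]$), $\boldsymbol{z}_{it}\in\mathbb{R}^m$ and $\eta_{it}\ge 0$ ($i\in[N]$, $t\in T(\boldsymbol{x})$) such that $$\lambda\delta+\frac1N\sum_{i=1}^N s_i\le\epsilon,$$ $$G_{f_t}(\boldsymbol{z}_{it},\eta_{it},\boldsymbol{x})+1-\boldsymbol{z}_{it}^{\top}\boldsymbol{\zeta}^i-s_i\le 0\quad\forall i\in[N],\ \forall t\in T(\boldsymbol{x}),$$ $$\|\boldsymbol{z}_{it}\|_*-\lambda\le 0\quad\forall i\in[N],\ \forall t\in T(\boldsymbol{x}),$$ where $G_{f_t}(\boldsymbol{z},\eta,\boldsymbol{x})=\sup_{\boldsymbol{\xi}\in\Xi}[\boldsymbol{z}^{\top}\boldsymbol{\xi}-\eta f_t(\boldsymbol{x},\boldsymbol{\xi})]$ and $T(\boldsymbol{x})=\{t\in[T]:\exists\boldsymbol{\xi}\in\Xi,\ f_t(\boldsymbol{x},\boldsymbol{\xi})<0\}$.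
   Context: Setting: $\boldsymbol{x}\in\mathbb{R}^n$ is a decision vector, $\boldsymbol{\xi}\in\mathbb{R}^m$ a random vector supported on $\Xi\subseteq\mathbb{R}^m$, $T\ge1$, $[T]=\{1,\dots,T\}$, $\epsilon\in(0,1)$. Assumptions: (A1) each $f_t:\mathbb{R}^n\times\Xi\to\mathbb{R}$, $t\in[T]$, is convex and continuous in $\boldsymbol{\xi}$ for fixed $\boldsymbol{x}$ and concave and continuous in $\boldsymbol{x}$ for fixed $\boldsymbol{\xi}$; (A2) $\Xi$ is a nonempty closed convex set. $\|\cdot\|$ is an arbitrary norm on $\mathbb{R}^m$ with dual norm $\|\boldsymbol{z}\|_*=\sup_{\|\boldsymbol{\xi}\|\le1}\boldsymbol{z}^{\top}\boldsymbol{\xi}$. Given samples $\boldsymbol{\zeta}^1,\dots,\boldsymbol{\zeta}^N\in\Xi$ with empirical distribution $\mathbb{P}_{\tilde\zeta}$ (mass $1/N$ on each), and radius $\delta>0$, the Wasserstein ambiguity set is $\mathcal{P}_W=\{\mathbb{P}:\mathbb{P}\{\boldsymbol{\xi}\in\Xi\}=1,\ W(\mathbb{P},\mathbb{P}_{\tilde\zeta})\le\delta\}$, where $W(\mathbb{P}_1,\mathbb{P}_2)=\inf_{\mathbb{Q}}\int_{\Xi\times\Xi}\|\boldsymbol{\xi}_1-\boldsymbol{\xi}_2\|\,\mathbb{Q}(d\boldsymbol{\xi}_1,d\boldsymbol{\xi}_2)$ over couplings $\mathbb{Q}$ with marginals $\mathbb{P}_1,\mathbb{P}_2$, for distributions on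 $\Xi$ with finite first moment. *)

(* Defs.v *)
From HB Require Import structures.
From mathcomp Require Import all_boot all_order all_algebra.
From mathcomp Require Import all_classical all_reals all_analysis.
Set Implicit Arguments. Unset Strict Implicit. Unset Printing Implicit Defensive.
Import Order.TTheory GRing.Theory Num.Theory.
Import numFieldNormedType.Exports.
Local Open Scope classical_set_scope.
Local Open Scope ring_scope.

Definition Borel_rV (R : realType) (m : nat) : Type :=
  g_sigma_algebraType (@open 'rV[R]_m).

Definition dotv (R : realType) (m : nat) (u v : 'rV[R]_m) : R :=
  \sum_(i < m) u 0 i * v 0 i.

Definition is_norm (R : realType) (m : nat) (nrm : 'rV[R]_m -> R) : Prop :=
  [/\ forall x, nrm x = 0 -> x = 0,
      forall (a : R) x, nrm (a *: x) = `|a| * nrm x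
    & forall x y, nrm (x + y) <= nrm x + nrm y].

Definition dual_norm (R : realType) (m : nat) (nrm : 'rV[R]_m -> R)
    (z : 'rV[R]_m) : R :=
  sup [set dotv z xi | xi in [set xi : 'rV[R]_m | nrm xi <= 1]].

Definition convex_set_rV (R : realType) (m : nat) (A : set 'rV[R]_m) : Prop :=
  forall a b, A a -> A b -> forall l : R, 0 <= l <= 1 ->
    A (l *: a + (1 - l) *: b).

Definition convex_on_rV (R : realType) (m : nat) (A : set 'rV[R]_m)
    (g : 'rV[R]_m -> R) : Prop :=
  forall a b, A a -> A b -> forall l : R, 0 <= l <= 1 ->
    g (l *: a + (1 - l) *: b) <= l * g a + (1 - l) * g b.

Definition concave_rV (R : realType) (n : nat) (g : 'rV[R]_n -> R) : Prop :=
  forall a b, forall l : R, 0 <= l <= 1 ->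
    l * g a + (1 - l) * g b <= g (l *: a + (1 - l) *: b).

Definition empirical (R : realType) (m N : nat) (zeta : 'I_N -> 'rV[R]_m)
    (A : set (Borel_rV R m)) : \bar R :=
  ((N%:R)^-1 * \sum_(i < N) (\1_A (zeta i) : R))%:E.

Definition coupling (R : realType) (m : nat)
    (Q : probability (Borel_rV R m * Borel_rV R m)%type R)
    (P1 P2 : set (Borel_rV R m) -> \bar R) : Prop :=
  forall A : set (Borel_rV R m), measurable A ->
    Q (A `*` setT) = P1 A /\ Q (setT `*` A) = P2 A.

Definition wasserstein (R : realType) (m : nat) (nrm : 'rV[R]_m -> R)
    (P1 P2 : set (Borel_rV R m) -> \bar R) : \bar R :=
  ereal_inf [set (\int[Q]_w (nrm (w.1 - w.2))%:E)%E |
     Q in [set Q : probability (Borel_rV R m * Borel_rV R m)%type R |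
            coupling Q P1 P2]].

Definition finite_first_moment (R : realType) (m : nat) (nrm : 'rV[R]_m -> R)
    (P : probability (Borel_rV R m) R) : Prop :=
  (\int[P]_xi (nrm xi)%:E < +oo)%E.

Definition ambiguity_set (R : realType) (m N : nat) (nrm : 'rV[R]_m -> R)
    (Xi : set 'rV[R]_m) (zeta : 'I_N -> 'rV[R]_m) (delta : R) :
    set (probability (Borel_rV R m) R) :=
  [set P : probability (Borel_rV R m) R | P Xi = 1%E /\ finite_first_moment nrm P /\
           (wasserstein nrm P (empirical zeta) <= delta%:E)%E].

Definition Z_D (R : realType) (n m Tn N : nat) (nrm : 'rV[R]_m -> R)
    (Xi : set 'rV[R]_m) (f : 'I_Tn -> 'rV[R]_n -> 'rV[R]_m -> R)
    (zeta : 'I_N -> 'rV[R]_m) (delta eps : R) : set 'rV[R]_n :=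
  [set x | (ereal_inf [set P [set xi : Borel_rV R m | Xi xi /\
                                 forall t, (0 <= f t x xi)%R]
                       | P in ambiguity_set nrm Xi zeta delta]
             >= (1 - eps)%:E)%E].

Definition G_f (R : realType) (n m : nat) (Xi : set 'rV[R]_m)
    (g : 'rV[R]_n -> 'rV[R]_m -> R) (z : 'rV[R]_m) (eta : R) (x : 'rV[R]_n)
    : \bar R :=
  ereal_sup [set (dotv z xi - eta * g x xi)%:E | xi in Xi].

Definition T_of (R : realType) (n m Tn : nat) (Xi : set 'rV[R]_m)
    (f : 'I_Tn -> 'rV[R]_n -> 'rV[R]_m -> R) (x : 'rV[R]_n) : set 'I_Tn :=
  [set t | exists2 xi, Xi xi & f t x xi < 0].

Definition Z_reform (R : realType) (n m Tn N : nat) (nrm : 'rV[R]_m -> R)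
    (Xi : set 'rV[R]_m) (f : 'I_Tn -> 'rV[R]_n -> 'rV[R]_m -> R)
    (zeta : 'I_N -> 'rV[R]_m) (delta eps : R) : set 'rV[R]_n :=
  [set x | exists (lam : R) (s : 'I_N -> R) (z : 'I_N -> 'I_Tn -> 'rV[R]_m)
                  (eta : 'I_N -> 'I_Tn -> R),
     [/\ 0 <= lam, (forall i, 0 <= s i),
         lam * delta + (N%:R)^-1 * \sum_(i < N) s i <= eps &
         forall i t, T_of Xi f x t ->
           [/\ 0 <= eta i t,
               (G_f Xi (f t) (z i t) (eta i t) x
                  + (1 - dotv (z i t) (zeta i) - s i)%:E <= 0)%E &
               dual_norm nrm (z i t) - lam <= 0]]].

(* Main.v *)
(** Fix [x] and let [B] be the set of scenarios violating some constraint.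
    Moving a fraction [p i] of the mass at [zeta i] into [B] costs at least
    [p i * dist (zeta i) B], so the worst-case probability of [B] over the
    Wasserstein ball is the value of a fractional knapsack problem, whose
    Lagrange dual is
    [min_lam lam * delta + N^-1 * \sum_i (1 - lam * dist (zeta i) B)^+].
    Membership in [Z_D] is thus the existence of [lam] and [s] such that
    [1 - s i <= lam * nrm (xi - zeta i)] whenever [f t x xi < 0]. For
    [t \in T_of Xi f x] this convex problem satisfies Slater's condition: its
    Lagrange multiplier is [eta i t], and Hahn-Banach replaces the norm by a
    linear functional [z i t] of dual norm at most [lam]. *)

Require Import Defs.
From HB Require Import structures.
From mathcomp Require Import all_boot all_order all_algebra.
From mathcomp Require Import all_classical all_reals all_analysis.
From mathcomp Require Import measurable_realfun.
From mathcomp Require Import ring lra.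
Import Order.TTheory GRing.Theory Num.Theory.
Import numFieldNormedType.Exports.
Set Implicit Arguments. Unset Strict Implicit. Unset Printing Implicit Defensive.
Local Open Scope classical_set_scope.
Local Open Scope ring_scope.

(** * Lagrange multipliers and Hahn-Banach in finite dimension *)

(** A multiplier must lie below [f0 a / - f1 a] wherever [f1 a < 0] and above [- f0 b / f1 b]
    wherever [f1 b > 0]. Convexity along the segment from [a] to [b] ([cross]) puts every lower
    quotient below every upper one, so the infimum of the upper ones works. *)
Lemma convex_lagrange (R : realType) (k : nat) (X : set 'rV[R]_k)
    (f0 f1 : 'rV[R]_k -> R) :
  convex_set_rV X -> convex_on_rV X f0 -> convex_on_rV X f1 ->
  (exists2 a, X a & f1 a < 0) ->
  (forall a, X a -> f1 a < 0 -> 0 <= f0 a) ->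
  exists2 eta, 0 <= eta & forall a, X a -> 0 <= f0 a + eta * f1 a.
Proof.
move=> cX cf0 cf1 [a0 Xa0 fa0] pos.
have cross a b : X a -> X b -> f1 a < 0 -> 0 <= f1 b ->
    0 <= f1 b * f0 a - f1 a * f0 b.
  move=> Xa Xb fa fb; rewrite leNgt; apply/negP => neg.
  have u0 := pos _ Xa fa.
  (* The weights proportional to [f1 b] and [- f1 a] give a point with [f1 <= 0]; adding [e] to the
     first makes it strictly feasible. This [e] is small enough to keep [f0] negative there, a
     contradiction; the [+ 1] covers [f0 a = 0]. *)
  pose e := - (f1 b * f0 a - f1 a * f0 b) / (2 * (f0 a + 1)).
  have e0 : 0 < e by apply: divr_gt0; lra.
  have eE : e * (f0 a + 1) * 2 = - (f1 b * f0 a - f1 a * f0 b).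
    by rewrite /e; field; lra.
  pose W := f1 b + e - f1 a; have W0 : 0 < W by rewrite /W; lra.
  pose l := (f1 b + e) / W.
  have lE : l * W = f1 b + e by rewrite /l; field; lra.
  have l01 : 0 <= l <= 1.
    apply/andP; split; first by apply: divr_ge0; lra.
    by rewrite /l ler_pdivrMr// mul1r /W; lra.
  have l1E : (1 - l) * W = - f1 a by rewrite mulrBl lE /W; ring.
  have h1 := cf1 _ _ Xa Xb _ l01.
  have h0 := cf0 _ _ Xa Xb _ l01.
  have lt0 : f1 (l *: a + (1 - l) *: b) < 0.
    apply: le_lt_trans h1 _; rewrite -(pmulr_llt0 _ W0).
    have -> : (l * f1 a + (1 - l) * f1 b) * W =
       (l * W) * f1 a + ((1 - l) * W) * f1 b by ring.
    by rewrite lE l1E; nra.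
  have {}h0 := le_trans (pos _ (cX _ _ Xa Xb _ l01) lt0) h0.
  have : 0 <= (l * f0 a + (1 - l) * f0 b) * W by apply: mulr_ge0 => //; lra.
  have -> : (l * f0 a + (1 - l) * f0 b) * W =
       (l * W) * f0 a + ((1 - l) * W) * f0 b by ring.
  rewrite lE l1E; nra.
pose S := [set f0 a / (- f1 a) | a in [set a | X a /\ f1 a < 0]].
have S0 : S !=set0 by exists (f0 a0 / (- f1 a0)); exists a0.
have lbS : lbound S 0.
  by move=> _ [a [Xa fa] <-]; apply: divr_ge0; [exact: pos|lra].
exists (inf S); first exact: lb_le_inf.
move=> b Xb; have [fb|fb] := ltP (f1 b) 0.
  have : inf S <= f0 b / (- f1 b).
    by apply: ge_inf; [exists 0|exists b].
  by rewrite ler_pdivlMr; lra.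
(* On the boundary no quotient is available; [cross] against the Slater point [a0] gives [0 <= f0 b]
   directly. *)
have [fb0|fb0] := eqVneq (f1 b) 0.
  by have := cross _ _ Xa0 Xb fa0 fb; rewrite fb0; nra.
have {fb fb0} fb : 0 < f1 b by rewrite lt_def fb0.
suff : - f0 b / f1 b <= inf S by rewrite ler_pdivrMr//; lra.
apply: lb_le_inf => // _ [a [Xa fa] <-].
have := cross _ _ Xa Xb fa (ltW fb) => h.
by rewrite ler_pdivrMr// mulrAC ler_pdivlMr; lra.
Qed.

Definition sublinear (R : realType) (k : nat) (p : 'rV[R]_k -> R) : Prop :=
  (forall v w, p (v + w) <= p v + p w) /\
  (forall t v, 0 <= t -> p (t *: v) <= t * p v).

Lemma sublinear0 (R : realType) (k : nat) (p : 'rV[R]_k -> R) :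
  sublinear p -> p 0 = 0.
Proof.
move=> [pD pZ]; have := pD 0 0; have := pZ 0 0 (lexx _).
rewrite addr0 scale0r; lra.
Qed.

(** [K] is a convex cone playing the role of an epigraph, and [p] is its lower boundary. A point [s]
    above [- v] bounds the fibre above [v] from below by [- s], since sums land above [0]. *)
Lemma cone_sublinear (R : realType) (k : nat) (K : 'rV[R]_k -> R -> Prop) :
  (forall v, exists r, K v r) ->
  (forall v w r s, K v r -> K w s -> K (v + w) (r + s)) ->
  (forall t v r, 0 <= t -> K v r -> K (t *: v) (t * r)) ->
  (forall r, K 0 r -> 0 <= r) ->
  exists2 p, sublinear p & forall v r, K v r -> p v <= r.
Proof.
move=> Kt KD KZ K0; pose p v := inf [set r | K v r].
have lb v : has_lbound [set r | K v r].
  have [s Ks] := Kt (- v); exists (- s) => r Kr.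
  by have := K0 (r + s); rewrite -(subrr v) => /(_ (KD _ _ _ _ Kr Ks)); lra.
have ple v r : K v r -> p v <= r by move=> Kr; exact: ge_inf.
exists p => //; split=> [v w|t v].
  rewrite -lerBlDr; apply: lb_le_inf; first exact: Kt.
  move=> r Kr; rewrite lerBlDr -lerBlDl.
  apply: lb_le_inf; first exact: Kt.
  by move=> s Ks; rewrite lerBlDl; apply/ple/KD.
rewrite le_eqVlt => /predU1P[<-|t0].
  by rewrite mul0r; apply/ple; have [r Kr] := Kt v;
    have := KZ 0 _ _ (lexx _) Kr; rewrite mul0r.
rewrite mulrC -ler_pdivrMr//; apply: lb_le_inf; first exact: Kt.
by move=> r Kr; rewrite ler_pdivrMr// mulrC; apply/ple/KZ => //; exact: ltW.
Qed.

(** One Hahn-Banach step: [q v] is the infimum over [t >= 0] of [p (v + t *: e) - t * p e]. Taking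
    [t = 1] at [- e] and [t = 0] at [e] yields [q (- e) <= - p e <= - q e], which is linearity along
    [e]. *)
Lemma sublinear_linear_along (R : realType) (k : nat) (p : 'rV[R]_k -> R)
    (e : 'rV[R]_k) : sublinear p ->
  exists q, [/\ sublinear q, forall v, q v <= p v & q (- e) <= - q e].
Proof.
move=> sp; have [pD pZ] := sp.
have [||||q sq qK] := @cone_sublinear R k
  (fun v r => exists2 t, 0 <= t & p (v + t *: e) - t * p e <= r).
- by move=> v; exists (p v), 0 => //; rewrite scale0r addr0 mul0r subr0.
- move=> v w r s [t t0 tr] [u u0 us]; exists (t + u); first exact: addr_ge0.
  have := pD (v + t *: e) (w + u *: e).
  by rewrite scalerDl addrACA; lra.
- move=> t v r t0 [u u0 ur]; exists (t * u); first exact: mulr_ge0.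
  rewrite -scalerA -scalerDr; have := pZ t (v + u *: e) t0.
  have := ler_wpM2l t0 ur; lra.
- move=> r [t t0]; rewrite add0r; have := pZ t e t0.
  have h := pD (t *: e) (t *: - e).
  have := pZ t^-1 (t *: e); rewrite invr_ge0 => /(_ t0).
  have [->|tn] := eqVneq t 0; first by rewrite scale0r mul0r sublinear0//; lra.
  rewrite scalerA mulVf// scale1r mulrC ler_pdivlMr ?lt_def ?tn//; lra.
exists q; split=> // [v|].
  by apply: qK; exists 0 => //; rewrite scale0r addr0 mul0r subr0.
have q1 : q (- e) <= - p e.
  by apply: qK; exists 1 => //; rewrite scale1r addNr sublinear0//; lra.
have q2 : q e <= p e.
  by apply: qK; exists 0 => //; rewrite scale0r addr0 mul0r subr0.
by apply: le_trans q1 _; rewrite lerN2.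
Qed.

(** The functional is made linear along each basis vector in turn, and [z] collects the resulting
    values [q (e i)]. Then [q (- v) <= - dotv z v], and [0 <= q v + q (- v)] gives the claim. *)
Lemma sublinear_ge_linear (R : realType) (k : nat) (p : 'rV[R]_k -> R) :
  sublinear p -> exists z, forall v, dotv z v <= p v.
Proof.
move=> sp; pose e i : 'rV[R]_k := delta_mx 0 i.
have [q [sq qp qe]] : exists q, [/\ sublinear q, forall v, q v <= p v &
    forall i, i \in enum 'I_k -> q (- e i) <= - q (e i)].
  elim: (enum 'I_k) => [|i s [q [sq qp qe]]]; first by exists p; split.
  have [r [sr rq re]] := sublinear_linear_along (e i) sq.
  exists r; split=> // [v|j]; first exact: le_trans (rq v) (qp v).
  (* Linearity along the earlier vectors survives because the functional only decreases. *)
  rewrite inE => /predU1P[->//|/qe qj].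
  apply: le_trans (rq _) (le_trans qj _).
  by rewrite lerN2.
have [qD qZ] := sq.
exists (\row_i q (e i)) => v; apply: le_trans (qp v).
have qi i : q (- v 0 i *: e i) <= - (v 0 i * q (e i)).
  have [vi|vi] := leP (v 0 i) 0.
    by rewrite -mulNr; apply: qZ; rewrite oppr_ge0.
  rewrite scaleNr -scalerN; apply: le_trans (qZ _ _ (ltW vi)) _.
  by rewrite -mulrN ler_pM2l//; apply: qe; rewrite mem_enum.
have : q (- v) <= - dotv (\row_i q (e i)) v.
  have -> : - v = \sum_i (- v 0 i) *: e i.
    by rewrite {1}(row_sum_delta v) -sumrN; apply: eq_bigr => i _; rewrite scaleNr.
  rewrite /dotv -sumrN.
  apply: (@big_ind2 _ _ (fun a b => q a <= b)).
  - by rewrite sublinear0.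
  - by move=> a b c d ab cd; apply: le_trans (qD _ _) _; apply: lerD.
  - by move=> i _; rewrite mxE mulrC.
have := qD v (- v); rewrite subrr sublinear0//; lra.
Qed.

Lemma is_norm0 (R : realType) (m : nat) (nrm : 'rV[R]_m -> R) :
  is_norm nrm -> nrm 0 = 0.
Proof. by case=> _ /(_ 0 0); rewrite scale0r normr0 mul0r. Qed.

Lemma is_normN (R : realType) (m : nat) (nrm : 'rV[R]_m -> R) v :
  is_norm nrm -> nrm (- v) = nrm v.
Proof. by case=> _ /(_ (-1) v); rewrite scaleN1r normrN1 mul1r. Qed.

Lemma is_norm_ge0 (R : realType) (m : nat) (nrm : 'rV[R]_m -> R) v :
  is_norm nrm -> 0 <= nrm v.
Proof.
move=> hn; have [_ _ /(_ v (- v))] := hn.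
by rewrite subrr is_norm0// is_normN//; lra.
Qed.

Lemma is_normB (R : realType) (m : nat) (nrm : 'rV[R]_m -> R) v w :
  is_norm nrm -> nrm (v - w) = nrm (w - v).
Proof. by move=> hn; rewrite -opprB is_normN. Qed.

Lemma is_norm_convex (R : realType) (m : nat) (nrm : 'rV[R]_m -> R)
    (A : set 'rV[R]_m) (lam c : R) (w : 'rV[R]_m) :
  is_norm nrm -> 0 <= lam ->
  convex_on_rV A (fun v => lam * nrm (v - w) - c).
Proof.
move=> [_ nZ nD] lam0 a b _ _ l /andP[l0 l1].
have -> : l *: a + (1 - l) *: b - w = l *: (a - w) + (1 - l) *: (b - w).
  by apply/rowP => i; rewrite !mxE; ring.
have := nD (l *: (a - w)) ((1 - l) *: (b - w)).
rewrite !nZ !ger0_norm ?subr_ge0// => /(ler_wpM2l lam0); lra.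
Qed.

(* Hahn-Banach applied to the sublinear functional
   v |-> inf_{t >= 0, xi} lam * nrm (v + t (xi - w)) + t * h xi. *)
Lemma norm_sandwich (R : realType) (m : nat) (nrm : 'rV[R]_m -> R)
    (Xi : set 'rV[R]_m) (h : 'rV[R]_m -> R) (lam : R) (w : 'rV[R]_m) :
  is_norm nrm -> 0 <= lam -> Xi !=set0 -> convex_set_rV Xi ->
  convex_on_rV Xi h ->
  (forall xi, Xi xi -> 0 <= lam * nrm (xi - w) + h xi) ->
  exists2 z, forall v, dotv z v <= lam * nrm v &
    forall xi, Xi xi -> dotv z (w - xi) <= h xi.
Proof.
move=> hn lam0 [x0 Xx0] cX ch pos; have [_ nZ nD] := hn.
have [||||p sp pK] := @cone_sublinear R m (fun v r => exists t xi,
    [/\ 0 <= t, Xi xi & lam * nrm (v + t *: (xi - w)) + t * h xi <= r]).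
- move=> v; exists (lam * nrm v), 0, x0; split => //.
  by rewrite scale0r addr0 mul0r addr0.
- move=> v v' r r' [t [xi [t0 Xxi hr]]] [t' [xi' [t0' Xxi' hr']]].
  have [tt0|tt0] := eqVneq (t + t') 0.
    have [tE tE'] : t = 0 /\ t' = 0 by split; lra.
    exists 0, x0; move: hr hr'; rewrite tE tE' !scale0r !mul0r !addr0 => hr hr'.
    by split=> //; have := ler_wpM2l lam0 (nD v v'); lra.
  have {}tt0 : 0 < t + t' by rewrite lt_def tt0 addr_ge0.
  (* Multipliers add up, and the two points are averaged in proportion to their multipliers, so that
     the total displacement is preserved. *)
  pose l := t / (t + t').
  have lE : l * (t + t') = t by rewrite /l; field; lra.
  have lE' : (1 - l) * (t + t') = t' by rewrite mulrBl lE; ring.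
  have l01 : 0 <= l <= 1.
    apply/andP; split; first by apply: divr_ge0; lra.
    by rewrite /l ler_pdivrMr// mul1r; lra.
  exists (t + t'), (l *: xi + (1 - l) *: xi'); split; [lra|exact: cX|].
  have -> : v + v' + (t + t') *: (l *: xi + (1 - l) *: xi' - w) =
      (v + t *: (xi - w)) + (v' + t' *: (xi' - w)).
    apply/rowP => i; rewrite !mxE.
    have -> : (t + t') * (l * xi 0 i + (1 - l) * xi' 0 i - w 0 i) =
      (l * (t + t')) * xi 0 i + ((1 - l) * (t + t')) * xi' 0 i
       - (t + t') * w 0 i by ring.
    by rewrite lE lE'; ring.
  have h1 := ler_wpM2l lam0 (nD (v + t *: (xi - w)) (v' + t' *: (xi' - w))).
  have := ler_wpM2r (ltW tt0) (ch _ _ Xxi Xxi' _ l01).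
  have -> : (l * h xi + (1 - l) * h xi') * (t + t') =
    (l * (t + t')) * h xi + ((1 - l) * (t + t')) * h xi' by ring.
  by rewrite lE lE'; lra.
- move=> s v r s0 [t [xi [t0 Xxi hr]]]; exists (s * t), xi; split => //.
    exact: mulr_ge0.
  rewrite -scalerA -scalerDr nZ ger0_norm//.
  by have := ler_wpM2l s0 hr; lra.
- move=> r [t [xi [t0 Xxi]]]; rewrite add0r nZ ger0_norm//.
  by have := mulr_ge0 t0 (pos _ Xxi); lra.
have [z zp] := sublinear_ge_linear sp; exists z => [v|xi Xxi].
  apply: le_trans (zp v) (pK _ _ _); exists 0, x0; split=> //.
  by rewrite scale0r addr0 mul0r addr0.
(* At [v = w - xi] with [t = 1] the norm term vanishes and only [h xi] remains. *)
apply: le_trans (zp _) (pK _ _ _); exists 1, xi; split=> //.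
by rewrite scale1r addrA subrK subrr is_norm0// mulr0 add0r mul1r.
Qed.

Lemma dotvBr (R : realType) (m : nat) (z v w : 'rV[R]_m) :
  dotv z (v - w) = dotv z v - dotv z w.
Proof.
by rewrite /dotv -sumrB; apply: eq_bigr => i _; rewrite !mxE mulrBr.
Qed.

Lemma dotvZr (R : realType) (m : nat) (z v : 'rV[R]_m) (a : R) :
  dotv z (a *: v) = a * dotv z v.
Proof.
by rewrite /dotv mulr_sumr; apply: eq_bigr => i _; rewrite !mxE mulrCA.
Qed.

Lemma dotv0r (R : realType) (m : nat) (z : 'rV[R]_m) : dotv z 0 = 0.
Proof. by rewrite -(subrr 0) dotvBr subrr. Qed.

Lemma dotvNr (R : realType) (m : nat) (z v : 'rV[R]_m) :
  dotv z (- v) = - dotv z v.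
Proof. by rewrite -[- v]add0r dotvBr dotv0r sub0r. Qed.

Lemma dotvNl (R : realType) (m : nat) (z v : 'rV[R]_m) :
  dotv (- z) v = - dotv z v.
Proof. by rewrite /dotv -sumrN; apply: eq_bigr => i _; rewrite mxE mulNr. Qed.

(** The Lagrange multiplier [eta] turns the implication into [0 <= lam * nrm (xi - w) + (eta * g xi
    - c)] on all of [Xi]; the sandwich then replaces the norm by a linear functional, whose sign is
    flipped at the end. *)
Lemma norm_constraint_duality (R : realType) (m : nat) (nrm : 'rV[R]_m -> R)
    (Xi : set 'rV[R]_m) (g : 'rV[R]_m -> R) (lam c : R) (w : 'rV[R]_m) :
  is_norm nrm -> 0 <= lam -> convex_set_rV Xi -> convex_on_rV Xi g ->
  (exists2 xi, Xi xi & g xi < 0) ->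
  (forall xi, Xi xi -> g xi < 0 -> c <= lam * nrm (xi - w)) ->
  exists z eta, [/\ 0 <= eta, forall v, dotv z v <= lam * nrm v &
    forall xi, Xi xi -> dotv z xi - eta * g xi <= dotv z w - c].
Proof.
move=> hn lam0 cX cg sl pos.
have [|eta eta0 heta] :=
    convex_lagrange cX (@is_norm_convex R m nrm Xi lam c w hn lam0) cg sl.
  by move=> a Xa ga; rewrite subr_ge0; exact: pos.
have [x0 Xx0 _] := sl.
have [||||z zn zX] := @norm_sandwich R m nrm Xi (fun v => eta * g v - c) lam w hn lam0.
- by exists x0.
- exact: cX.
- move=> a b Xa Xb l l01; have := ler_wpM2l eta0 (cg _ _ Xa Xb _ l01); lra.
- by move=> xi Xxi; have := heta _ Xxi; lra.
exists (- z), eta; split=> // [v|xi Xxi].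
  by rewrite dotvNl -dotvNr -(is_normN v hn).
by have := zX _ Xxi; rewrite dotvBr !dotvNl; lra.
Qed.

(** Lagrange duality for the fractional knapsack with budget [D]. As [D] is positive, [p = 0] is a
    Slater point, and a strict budget in the hypothesis suffices. *)
Lemma knapsack_duality (R : realType) (N : nat) (d : 'I_N -> R) (D c : R) :
  0 < D -> (forall i, 0 <= d i) ->
  (forall p : 'I_N -> R, (forall i, 0 <= p i <= 1) ->
     \sum_i p i * d i < D -> \sum_i p i <= c) ->
  exists2 lam, 0 <= lam &
    lam * D + \sum_i Num.max 0 (1 - lam * d i) <= c.
Proof.
move=> D0 d0 pc.
pose X := [set p : 'rV[R]_N | forall i, 0 <= p 0 i <= 1].
have sumE (a b : 'rV[R]_N) (l : R) (u : 'I_N -> R) :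
   \sum_i (l *: a + (1 - l) *: b) 0 i * u i =
   l * (\sum_i a 0 i * u i) + (1 - l) * \sum_i b 0 i * u i.
  rewrite !mulr_sumr -big_split; apply: eq_bigr => i _ /=.
  by rewrite !mxE; ring.
have [|||||lam lam0 h] := @convex_lagrange R N X
    (fun p => c - \sum_i p 0 i * 1) (fun p => \sum_i p 0 i * d i - D).
- move=> a b Xa Xb l /andP[l0 l1] i; rewrite !mxE.
  have /andP[? ?] := Xa i; have /andP[? ?] := Xb i; nra.
- by move=> a b _ _ l _; rewrite (sumE _ _ _ (fun=> 1)); lra.
- by move=> a b _ _ l _; rewrite sumE; lra.
- exists 0; first by move=> i; rewrite mxE; apply/andP; split; lra.
  by rewrite big1 ?sub0r ?oppr_lt0// => i _; rewrite mxE mul0r.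
- move=> a Xa; rewrite subr_lt0 subr_ge0 => ad.
  by under eq_bigr do rewrite mulr1; exact: pc.
exists lam => //.
(* The Lagrangian is linear in each [p i], hence extremal at this 0-1 vector, where it produces the
   positive parts. *)
have := h (\row_i (0 < 1 - lam * d i)%R%:R) _.
have Xr : X (\row_i (0 < 1 - lam * d i)%R%:R).
  by move=> i; rewrite mxE ler0n lern1 leq_b1.
move=> /(_ Xr).
suff -> : \sum_i Num.max 0 (1 - lam * d i) =
  \sum_i (\row_i (0 < 1 - lam * d i)%R%:R : 'rV[R]_N) 0 i * 1 -
  lam * (\sum_i (\row_i (0 < 1 - lam * d i)%R%:R : 'rV[R]_N) 0 i * d i) by lra.
rewrite mulr_sumr -sumrB; apply: eq_bigr => i _; rewrite mxE.
by case: ltP => _; rewrite ?mulr1n ?mulr0n; ring.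
Qed.

(** * Norms and measurability *)

Lemma coord_le_mx_norm (R : realType) (m : nat) (v : 'rV[R]_m) (i : 'I_m) :
  `|v 0 i| <= `|v|.
Proof.
rewrite [leRHS]/Num.norm/= mx_normrE.
exact: (le_bigmax _ (fun ij : 'I_1 * 'I_m => `|v ij.1 ij.2|) (0, i)).
Qed.

Lemma is_norm_le_mx_norm (R : realType) (m : nat) (nrm : 'rV[R]_m -> R) :
  is_norm nrm -> exists2 C, 0 < C & forall v, nrm v <= C * `|v|.
Proof.
move=> hn; have [_ nZ nD] := hn; pose e i : 'rV[R]_m := delta_mx 0 i.
(* The [1] keeps the constant positive even in dimension 0. *)
exists (1 + \sum_i nrm (e i)).
  by rewrite ltr_pwDl// sumr_ge0// => i _; exact: is_norm_ge0.
move=> v; rewrite mulrDl mul1r.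
suff : nrm v <= (\sum_i nrm (e i)) * `|v| by have := normr_ge0 v; lra.
rewrite {1}(row_sum_delta v) mulr_suml.
apply: (@big_ind2 _ _ (fun a b => nrm a <= b)).
- by rewrite is_norm0.
- by move=> a b c d ab cd; apply: le_trans (nD _ _) _; apply: lerD.
- move=> i _; rewrite nZ mulrC ler_wpM2l// ?is_norm_ge0//.
  exact: coord_le_mx_norm.
Qed.

Lemma lipschitz_continuous (R : realType) (m : nat) (nrm g : 'rV[R]_m -> R) :
  is_norm nrm -> (forall v w, g v <= g w + nrm (v - w)) -> continuous g.
Proof.
move=> hn gl v; have [C C0 hC] := is_norm_le_mx_norm hn.
apply/(@cvgrPdist_lt _ _ _ _ (nbhs_filter v)) => e e0.
have := nbhsx_ballx v (e / C) (divr_gt0 e0 C0).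
apply: filterS => w; rewrite -ball_normE /= => vwC.
 have vw : nrm (v - w) < e.
  by apply: le_lt_trans (hC _) _; rewrite mulrC -ltr_pdivlMr.
rewrite ltr_norml; have := gl v w; have := gl w v; rewrite (is_normB w v hn).
by move=> h1 h2; apply/andP; split; lra.
Qed.

Lemma is_norm_continuous (R : realType) (m : nat) (nrm : 'rV[R]_m -> R)
    (a : 'rV[R]_m) : is_norm nrm -> continuous (fun v : 'rV[R]_m => nrm (v - a)).
Proof.
move=> hn; apply: (lipschitz_continuous hn) => v w.
have [_ _ nD] := hn; have := nD (w - a) (v - w).
by rewrite addrC -(addrA v) addKr.
Qed.

(** Equivalence of norms: [nrm] is continuous and attains a positive minimum on the compact unit
    sphere of the sup norm. The sphere is empty only in dimension 0. *)
Lemma mx_norm_le_is_norm (R : realType) (m : nat) (nrm : 'rV[R]_m -> R) :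
  is_norm nrm -> exists2 c, 0 < c & forall v, c * `|v| <= nrm v.
Proof.
move=> hn; have [n0 nZ nD] := hn; pose S := [set v : 'rV[R]_m | `|v| = 1].
have [S0|/set0P SN0] := eqVneq S set0.
  exists 1 => // v; have [->|v0] := eqVneq v 0.
    by rewrite normr0 mulr0 is_norm0.
  suff : S (`|v|^-1 *: v) by rewrite S0.
  by rewrite /S/= normrZ ger0_norm ?invr_ge0// mulVf// normr_eq0.
have cS : compact S.
  apply: bounded_closed_compact.
    by exists 1; split=> // x x1 v /= ->; exact: ltW.
  rewrite (_ : S = (fun v : 'rV[R]_m => `|v|) @^-1` [set 1]) //.
  have /continuous_closedP : continuous (fun v : 'rV[R]_m => `|v|).
    by move=> v; exact: norm_continuous.
  by apply; exact: closed_eq.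
have cn : {within S, continuous nrm}.
  apply: continuous_subspaceT.
  have := @is_norm_continuous R m nrm 0 hn.
  by under eq_fun do rewrite subr0.
have [v /[!inE] vS vmin] := EVT_min_rV SN0 cS cn.
exists (nrm v).
  rewrite lt_def is_norm_ge0// andbT; apply/eqP => /n0 v0.
  by move: vS; rewrite /S/= v0 normr0 => /esym/eqP; rewrite oner_eq0.
move=> w; have [->|w0] := eqVneq w 0.
  by rewrite normr0 mulr0 is_norm0.
have w0' : 0 < `|w| by rewrite normr_gt0.
have : nrm v <= nrm (`|w|^-1 *: w).
  apply: vmin; rewrite inE /S/= normrZ ger0_norm ?invr_ge0// mulVf//.
  by rewrite normr_eq0.
by rewrite nZ ger0_norm ?invr_ge0// mulrC ler_pdivlMr.
Qed.

Lemma dual_norm_le (R : realType) (m : nat) (nrm : 'rV[R]_m -> R)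
    (z : 'rV[R]_m) (lam : R) : is_norm nrm -> 0 <= lam ->
  dual_norm nrm z <= lam <-> forall v, dotv z v <= lam * nrm v.
Proof.
move=> hn lam0; have [n0 nZ nD] := hn; split=> [dn v|h]; last first.
  apply: sup_le_ub; first by exists (dotv z 0); exists 0 => //=; rewrite is_norm0.
  move=> _ [v /= v1 <-]; apply: le_trans (h v) _.
  by have := ler_wpM2l lam0 v1; rewrite mulr1.
have [->|v0] := eqVneq v 0; first by rewrite dotv0r is_norm0// mulr0.
have nv : 0 < nrm v.
  by rewrite lt_def is_norm_ge0// andbT; apply: contra v0 => /eqP/n0 ->.
have [c c0 hc] := mx_norm_le_is_norm hn.
have : dotv z ((nrm v)^-1 *: v) <= lam.
  apply: le_trans dn; apply: ub_le_sup; last first.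
    exists ((nrm v)^-1 *: v) => //=.
    by rewrite nZ gtr0_norm ?invr_gt0// mulVf// gt_eqF.
  (* A real [sup] is meaningful only on a bounded set; equivalence of norms bounds the coordinates
     of the unit ball of [nrm] by [c^-1]. *)
  exists (\sum_i `|z 0 i| * c^-1) => _ [w /= w1 <-].
  apply: ler_sum => i _; apply: le_trans (ler_norm _) _; rewrite normrM.
  apply: ler_wpM2l => //; apply: (@le_trans _ _ `|w|).
    exact: coord_le_mx_norm.
  by rewrite -[c^-1]mul1r ler_pdivlMr// mulrC; apply: le_trans w1.
by rewrite dotvZr mulrC ler_pdivrMr.
Qed.

Lemma open_measurable_rV (R : realType) (m : nat) (A : set 'rV[R]_m) :
  open A -> measurable (A : set (Borel_rV R m)).
Proof. by move=> oA; apply: sub_sigma_algebra. Qed.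

Lemma closed_measurable_rV (R : realType) (m : nat) (A : set 'rV[R]_m) :
  closed A -> measurable (A : set (Borel_rV R m)).
Proof.
move=> cA; rewrite -(setCK A); apply: measurableC; apply: open_measurable_rV.
exact: closed_openC.
Qed.

Lemma measurable_fun_ltr (d : measure_display) (T : measurableType d)
    (R : realType) (g : T -> R) :
  (forall r, measurable [set x | g x < r]) -> measurable_fun setT g.
Proof.
move=> mg; apply: (measurability _ (RGenInftyO.measurableE R)).
move=> _ [_ [r ->] <-]; rewrite setTI.
by have := mg r; congr measurable; apply/seteqP; split=> x /=; rewrite in_itv.
Qed.

Lemma continuous_measurable_rV (R : realType) (m : nat) (g : 'rV[R]_m -> R) :
  continuous g -> measurable_fun setT (g : Borel_rV R m -> R).
Proof.
move=> cg; apply: measurable_fun_ltr => r; apply: open_measurable_rV.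
rewrite (_ : [set x | _] = g @^-1` [set y | y < r])//.
by move/continuousP : cg; apply; exact: open_lt.
Qed.

(* The sigma-algebra here is the product of two Borel sigma-algebras, not the
   Borel sigma-algebra of the product, so continuity of w |-> nrm (w.1 - w.2) is
   not enough: nrm (a - b) < r iff nrm (a - q) + nrm (b - q) < r for a rational q. *)
Lemma measurable_norm_dist (R : realType) (m : nat) (nrm : 'rV[R]_m -> R) :
  is_norm nrm ->
  measurable_fun setT (fun w : Borel_rV R m * Borel_rV R m => nrm (w.1 - w.2)).
Proof.
move=> hn; have [_ _ nD] := hn; apply: measurable_fun_ltr => r.
pose rt (q : 'rV[rat]_m) : 'rV[R]_m := map_mx ratr q.
rewrite (_ : [set _ | _] = \bigcup_(q : 'rV[rat]_m)
   [set w : Borel_rV R m * Borel_rV R m | nrm (w.1 - rt q) + nrm (w.2 - rt q) < r]).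
  apply: countable_bigcupT_measurable => [|q]; first exact: countableP.
  have mq : measurable_fun setT (fun v : Borel_rV R m => nrm (v - rt q)).
    by apply: continuous_measurable_rV; exact: is_norm_continuous.
  have mh : measurable_fun setT (fun w : Borel_rV R m * Borel_rV R m =>
      nrm (w.1 - rt q) + nrm (w.2 - rt q)).
    by apply: measurable_funD; [apply: (measurableT_comp mq measurable_fst)|
      apply: (measurableT_comp mq measurable_snd)].
  rewrite -[X in measurable X]setTI.
  rewrite (_ : [set _ | _] = (fun w : Borel_rV R m * Borel_rV R m =>
      nrm (w.1 - rt q) + nrm (w.2 - rt q)) @^-1` `]-oo, r[%classic); last first.
    by apply/seteqP; split=> x /=; rewrite in_itv.
  by apply: mh => //; exact: measurable_itv.
apply/seteqP; split=> [[a b]/= ab|[a b]/= [q _ /=]]; last first.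
  apply: le_lt_trans; rewrite (is_normB b _ hn).
  by have := nD (a - rt q) (rt q - b); rewrite addrA subrK.
have [C C0 hC] := is_norm_le_mx_norm hn.
(* If [q] is within [e] of [b] in each coordinate, then [nrm (b - q) < C * e], and the detour
   through [q] costs less than the slack [2 * (C * e)]. *)
pose e := (r - nrm (a - b)) / (2 * C).
have e0 : 0 < e by apply: divr_gt0; lra.
have eE : 2 * (C * e) = r - nrm (a - b) by rewrite /e; field; lra.
have rat_i i : exists x : rat, `|b 0 i - ratr x| < e.
  have [|x] := @rat_in_itvoo R (b 0 i - e) (b 0 i + e); first lra.
  rewrite in_itv/= => /andP[h1 h2]; exists x.
  by rewrite ltr_norml; apply/andP; split; lra.
have [x hx] := choice rat_i.
exists (\row_i x i) => //=.
have bq : nrm (b - rt (\row_i x i)) < C * e.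
  apply: le_lt_trans (hC _) _; rewrite ltr_pM2l//.
  rewrite [ltLHS]/Num.norm/= mx_normrE; apply/bigmax_ltP; split=> // -[j i] _ /=.
  by rewrite !mxE ord1.
have := nD (a - b) (b - rt (\row_i x i)); rewrite addrA subrK; lra.
Qed.

(** Adding one scaled Dirac mass at a time lets the integral formula follow from additivity in the
    measure. *)
Lemma finite_support_measure (d : measure_display) (T : measurableType d)
    (R : realType) (I : Type) (s : seq I) (a : I -> T) (w : I -> R) :
  (forall i, 0 <= w i) ->
  exists mu : {measure set T -> \bar R},
    (forall A, mu A = (\sum_(i <- s) w i * \1_A (a i))%:E) /\
    (forall g : T -> R, measurable_fun setT g -> (forall x, 0 <= g x) ->
       (\int[mu]_x (g x)%:E = (\sum_(i <- s) w i * g (a i))%:E)%E).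
Proof.
move=> w0; elim: s => [|i s [mu [muE muI]]].
  exists mzero; split=> [A|g _ _]; first by rewrite big_nil.
  by rewrite big_nil integral_measure_zero.
exists (measure_add (mscale (NngNum (w0 i)) (dirac (a i))) mu).
split=> [A|g mg g0].
  by rewrite [LHS]measure_addE big_cons EFinD muE EFinM /mscale/= /dirac.
have mgE : measurable_fun setT (EFin \o g) by exact/measurable_EFinP.
rewrite ge0_integral_measure_add//; last first.
  by move=> x _; rewrite lee_fin.
rewrite muI// ge0_integral_mscale//; last by move=> x _; rewrite lee_fin.
rewrite integral_dirac// diracT mul1e big_cons EFinD EFinM.
by [].
Qed.

Lemma finite_support_probability (d : measure_display) (T : measurableType d)
    (R : realType) (I : finType) (a : I -> T) (w : I -> R) :
  (forall i, 0 <= w i) -> \sum_i w i = 1 ->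
  exists P : probability T R,
    (forall A, P A = (\sum_i w i * \1_A (a i))%:E) /\
    (forall g : T -> R, measurable_fun setT g -> (forall x, 0 <= g x) ->
       (\int[P]_x (g x)%:E = (\sum_i w i * g (a i))%:E)%E).
Proof.
move=> w0 w1; have [mu [muE muI]] := finite_support_measure (index_enum I) a w0.
have muT : mu setT = 1%E.
  by rewrite muE -[in RHS]w1; congr (_%:E); apply: eq_bigr => i _; rewrite indicT mulr1.
have [i0 _|I0] := pickP I; last first.
  by move: w1; rewrite big_pred0 => // /eqP; rewrite eq_sym oner_eq0.
(* Normalization packages [mu] as a probability; as its total mass is 1, the values are
   unchanged. *)
pose P : probability T R := mnormalize mu (dirac (a i0)).
have PE A : P A = mu A.
  by rewrite /P/= /mnormalize muT onee_eq0 /= invr1 mule1.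
exists P; split=> [A|g mg g0]; first by rewrite PE.
by rewrite -muI//; apply: eq_measure_integral => A _ _; exact: PE.
Qed.

(** * Wasserstein balls around the empirical distribution *)

(** Continuity holds only within [Xi], so each superlevel set is closed relative to [Xi];
    intersecting it with the closed set [Xi] makes it closed. *)
Lemma closed_superlevel (R : realType) (m Tn : nat) (Xi : set 'rV[R]_m)
    (g : 'I_Tn -> 'rV[R]_m -> R) :
  closed Xi -> (forall t, {within Xi, continuous (g t)}) ->
  closed [set xi | Xi xi /\ forall t, 0 <= g t xi].
Proof.
move=> cXi cg.
rewrite (_ : [set _ | _] =
    Xi `&` \bigcap_t (Xi `&` g t @^-1` [set y | 0 <= y])); last first.
  apply/seteqP; split=> xi /=; first by move=> [Xxi h]; split=> // t _; split=> //=; exact: h.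
  by move=> [Xxi h]; split=> // t; have [] := h t I.
apply: closedI => //; apply: closed_bigI => t _.
rewrite closed_setSI//.
by move/continuous_closedP : (cg t); apply; exact: closed_ge.
Qed.

(** For empty [B] this infimum takes the default value 0, not infinity; hence the later assumptions
    [B !=set0]. *)
Definition nrm_dist (R : realType) (m : nat) (nrm : 'rV[R]_m -> R)
    (B : set 'rV[R]_m) (v : 'rV[R]_m) : R :=
  inf [set nrm (xi - v) | xi in B].

Lemma nrm_dist_le (R : realType) (m : nat) (nrm : 'rV[R]_m -> R)
    (B : set 'rV[R]_m) (v xi : 'rV[R]_m) :
  is_norm nrm -> B xi -> nrm_dist nrm B v <= nrm (xi - v).
Proof.
move=> hn Bxi; apply: ge_inf; last by exists xi.
by exists 0 => _ [w _ <-]; exact: is_norm_ge0.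
Qed.

Lemma le_nrm_dist (R : realType) (m : nat) (nrm : 'rV[R]_m -> R)
    (B : set 'rV[R]_m) (v : 'rV[R]_m) (c : R) :
  B !=set0 -> (forall xi, B xi -> c <= nrm (xi - v)) -> c <= nrm_dist nrm B v.
Proof.
move=> [b Bb] h; apply: lb_le_inf; first by exists (nrm (b - v)); exists b.
by move=> _ [w Bw <-]; exact: h.
Qed.

Lemma nrm_dist_ge0 (R : realType) (m : nat) (nrm : 'rV[R]_m -> R)
    (B : set 'rV[R]_m) (v : 'rV[R]_m) :
  is_norm nrm -> B !=set0 -> 0 <= nrm_dist nrm B v.
Proof. by move=> hn B0; apply: le_nrm_dist => // xi _; exact: is_norm_ge0. Qed.

Lemma nrm_dist_continuous (R : realType) (m : nat) (nrm : 'rV[R]_m -> R)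
    (B : set 'rV[R]_m) :
  is_norm nrm -> B !=set0 -> continuous (nrm_dist nrm B).
Proof.
move=> hn B0; apply: (lipschitz_continuous hn) => v w.
rewrite -lerBlDr; apply: le_nrm_dist => // xi Bxi.
rewrite lerBlDr; apply: le_trans (nrm_dist_le v hn Bxi) _.
have [_ _ nD] := hn; have := nD (xi - w) (w - v).
by rewrite addrA subrK (is_normB w v hn).
Qed.

(* Weak duality: integrate 1_B(w1) <= lam nrm(w1 - w2) + (1 - lam dist(w2,B))^+
   against a nearly optimal coupling. *)
Lemma wasserstein_ball_bound (R : realType) (m N : nat) (nrm : 'rV[R]_m -> R)
    (zeta : 'I_N -> 'rV[R]_m) (delta lam : R) (B : set 'rV[R]_m)
    (P : probability (Borel_rV R m) R) :
  is_norm nrm -> (0 < N)%N -> 0 <= lam -> B !=set0 ->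
  measurable (B : set (Borel_rV R m)) ->
  (wasserstein nrm P (empirical zeta) <= delta%:E)%E ->
  (P B <= (lam * delta +
     N%:R^-1 * \sum_i Num.max 0 (1 - lam * nrm_dist nrm B (zeta i)))%:E)%E.
Proof.
move=> hn N0 lam0 B0 mB hW.
pose s v := Num.max 0 (1 - lam * nrm_dist nrm B v).
have s0 v : 0 <= s v by rewrite /s le_max lexx.
have ms : measurable_fun setT (s : Borel_rV R m -> R).
  apply: measurable_maxr; first exact: measurable_cst.
  apply: measurable_funB; first exact: measurable_cst.
  apply: measurable_funM; first exact: measurable_cst.
  by apply: continuous_measurable_rV; exact: nrm_dist_continuous.
(* [empirical] is a bare set function; [P0] is the same distribution as a probability, against which
   one can integrate. *)
have [P0 [P0E P0I]] : exists P0 : probability (Borel_rV R m) R,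
    (forall A, P0 A = (\sum_(i < N) N%:R^-1 * \1_A (zeta i))%:E) /\
    (forall g : Borel_rV R m -> R, measurable_fun setT g -> (forall x, 0 <= g x) ->
       (\int[P0]_x (g x)%:E = (\sum_(i < N) N%:R^-1 * g (zeta i))%:E)%E).
  apply: finite_support_probability => [i|]; first by rewrite invr_ge0.
  by rewrite sumr_const card_ord -[_ *+ N]mulr_natr mulVf// pnatr_eq0 -lt0n.
rewrite [X in (_ <= X)%E](_ : _ = (lam * delta)%:E + \int[P0]_x (s x)%:E)%E; last first.
  by rewrite P0I// -EFinD mulr_sumr.
apply/lee_addgt0Pr => e e0.
(* The infimum over couplings need not be attained; an excess [e'] in transport cost contributes
   [lam * e' <= e], and the [+ 1] allows [lam = 0]. *)
pose e' := e / (lam + 1); have e'0 : 0 < e' by apply: divr_gt0; lra.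
have [_ [Q Qc <-] Qlt] : exists2 y, [set (\int[Q]_w (nrm (w.1 - w.2))%:E)%E |
     Q in [set Q : probability (Borel_rV R m * Borel_rV R m)%type R |
            coupling Q P (empirical zeta)]] y & (y < (delta + e')%:E)%E.
  by apply: ereal_inf_lt; apply: le_lt_trans hW _; rewrite lte_fin; lra.
have sE : (\int[Q]_w (s w.2)%:E = \int[P0]_x (s x)%:E)%E.
  transitivity (\int[pushforward Q snd]_x (s x)%:E)%E.
    rewrite ge0_integral_pushforward//=.
    - exact/measurable_EFinP.
    - by move=> y _; rewrite lee_fin.
  apply: eq_measure_integral => A mA _.
  have [_ QA] := Qc A mA; rewrite setTX in QA; apply: (etrans QA).
  by apply: (etrans _ (esym (P0E A))); rewrite /empirical mulr_sumr.
have mn := measurable_norm_dist hn.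
have PB : (P B = \int[Q]_w (\1_B w.1)%:E)%E.
  have [<- _] := Qc B mB.
  rewrite (_ : (fun w => (\1_B w.1)%:E) =
    (fun w : Borel_rV R m * Borel_rV R m => (\1_(B `*` setT) w)%:E)); last first.
    by apply/funext => w; rewrite !indicE in_setX in_setT andbT.
  by rewrite integral_indic ?setIT//; exact: measurableX.
have m1 : measurable_fun setT (fun w : Borel_rV R m * Borel_rV R m => lam * nrm (w.1 - w.2)).
  by apply: measurable_funM => //; exact: measurable_cst.
have m2 : measurable_fun setT (fun w : Borel_rV R m * Borel_rV R m => s w.2).
  exact: (measurableT_comp ms measurable_snd).
rewrite PB.
apply: (@le_trans _ _ (\int[Q]_w ((lam * nrm (w.1 - w.2))%:E + (s w.2)%:E))%E).
  apply: ge0_le_integral => //.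
  - apply/measurable_EFinP; apply: (measurableT_comp _ measurable_fst).
    exact: measurable_indic.
  - by apply/measurable_EFinP; exact: measurable_funD.
  - move=> [a b] _ /=; rewrite -EFinD lee_fin indicE.
    have [/[!inE] Ba|_] := boolP (a \in B).
      have := ler_wpM2l lam0 (nrm_dist_le b hn Ba).
      have : 1 - lam * nrm_dist nrm B b <= s b by rewrite /s le_max lexx orbT.
      by rewrite mulr1n; lra.
    by rewrite addr_ge0// mulr_ge0// is_norm_ge0.
rewrite ge0_integralD//; last 4 first.
- by move=> w _; rewrite lee_fin mulr_ge0// is_norm_ge0.
- exact/measurable_EFinP.
- by move=> w _; rewrite lee_fin.
- exact/measurable_EFinP.
rewrite sE [leRHS]addeAC; apply: leeD2r.
under eq_integral do rewrite EFinM.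
rewrite ge0_integralZl_EFin//; last 2 first.
- by move=> w _; rewrite lee_fin is_norm_ge0.
- exact/measurable_EFinP.
apply: (@le_trans _ _ (lam%:E * (delta + e')%:E)%E).
  by apply: lee_wpmul2l; rewrite ?lee_fin// ltW.
rewrite -EFinM -EFinD lee_fin mulrDr lerD2l /e' mulrA ler_pdivrMr; nra.
Qed.

(* Mass p i / N is moved from zeta i to xi i. *)
Lemma transport_ambiguity (R : realType) (m N : nat) (nrm : 'rV[R]_m -> R)
    (Xi : set 'rV[R]_m) (zeta xi : 'I_N -> 'rV[R]_m) (delta : R) (p : 'I_N -> R) :
  is_norm nrm -> (0 < N)%N ->
  (forall i, Xi (zeta i)) -> (forall i, Xi (xi i)) ->
  (forall i, 0 <= p i <= 1) ->
  \sum_i p i * nrm (xi i - zeta i) <= N%:R * delta ->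
  exists2 P, ambiguity_set nrm Xi zeta delta P &
    forall A, P A = (N%:R^-1 *
      \sum_i ((1 - p i) * \1_A (zeta i) + p i * \1_A (xi i)))%:E.
Proof.
move=> hn N0 Xz Xx p01 hp.
have NR0 : 0 < N%:R :> R by rewrite ltr0n.
(* Each sample splits into two atoms: [(i, true)] is the moved part and [(i, false)] the part that
   stays. *)
pose w (k : 'I_N * bool) : R := N%:R^-1 * (if k.2 then p k.1 else 1 - p k.1).
pose a (k : 'I_N * bool) : Borel_rV R m := if k.2 then xi k.1 else zeta k.1.
have w0 k : 0 <= w k.
  rewrite /w mulr_ge0 ?invr_ge0//; have /andP[h0 h1] := p01 k.1.
  by case: ifP => _ //; lra.
have sumE (F : 'I_N * bool -> R) : \sum_k w k * F k =
    N%:R^-1 * \sum_i ((1 - p i) * F (i, false) + p i * F (i, true)).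
  transitivity (\sum_i \sum_(b : bool) w (i, b) * F (i, b)).
    by rewrite pair_bigA; apply: eq_bigr => -[].
  rewrite mulr_sumr; apply: eq_bigr => i _.
  by rewrite big_bool /w/=; ring.
have w1 : \sum_k w k = 1.
  under eq_bigr do rewrite -[w _]mulr1.
  rewrite (sumE (fun=> 1)) (eq_bigr (fun=> 1)); last by move=> i _; ring.
  by rewrite sumr_const card_ord mulVf// gt_eqF.
have [P [PE PI]] := finite_support_probability a w0 w1.
(* The transport plan pairs each atom with the sample it came from, so only moved atoms incur a
   cost. *)
have [Q [QE QI]] := finite_support_probability
  (fun k => (a k, zeta k.1 : Borel_rV R m)) w0 w1.
have aX k : Xi (a k) by rewrite /a; case: ifP.
exists P; last by move=> A; rewrite PE sumE.
split; last split.
- rewrite PE -w1; congr (_%:E); apply: eq_bigr => k _.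
  by rewrite indicE mem_set// mulr1.
- rewrite /finite_first_moment PI ?ltry//; last by move=> v; exact: is_norm_ge0.
  apply: continuous_measurable_rV; have := @is_norm_continuous _ _ _ 0 hn.
  by under eq_fun do rewrite subr0.
- apply: (@le_trans _ _ (\int[Q]_w (nrm (w.1 - w.2))%:E)%E).
    apply: ereal_inf_lbound; exists Q => // A mA; split.
      rewrite QE PE; congr (_%:E); apply: eq_bigr => k _.
      by rewrite !indicE in_setX in_setT andbT.
    rewrite QE (sumE (fun k => \1_([set: Borel_rV R m] `*` A) (a k, zeta k.1 : Borel_rV R m))).
    rewrite /empirical; congr ((_ * _)%:E); apply: eq_bigr => i _.
    by rewrite !indicE !in_setX !in_setT /=; ring.
  rewrite QI; [|exact: measurable_norm_dist|by move=> v; exact: is_norm_ge0].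
  rewrite (sumE (fun k => nrm (a k - zeta k.1))) lee_fin mulrC ler_pdivrMr//.
  apply: le_trans (_ : _ <= N%:R * delta) _; last by rewrite mulrC.
  apply: le_trans hp; apply: ler_sum => i _ /=.
  by rewrite /a/= subrr is_norm0//; lra.
Qed.

(** * The reformulation *)

Definition unsafe_set (R : realType) (n m Tn : nat) (Xi : set 'rV[R]_m)
    (f : 'I_Tn -> 'rV[R]_n -> 'rV[R]_m -> R) (x : 'rV[R]_n) : set 'rV[R]_m :=
  [set xi | Xi xi /\ exists t, f t x xi < 0].

Lemma unsafe_setE (R : realType) (n m Tn : nat) (Xi : set 'rV[R]_m)
    (f : 'I_Tn -> 'rV[R]_n -> 'rV[R]_m -> R) (x : 'rV[R]_n) :
  unsafe_set Xi f x = Xi `\` [set xi | Xi xi /\ forall t, 0 <= f t x xi].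
Proof.
apply/seteqP; split=> xi /= [Xxi].
  by move=> [t ft]; split=> // -[_ /(_ t)]; rewrite leNgt ft.
move=> h; split=> //; apply/not_existsP => nt; apply: h; split=> // t.
by rewrite leNgt; apply/negP => ft; exact: (nt t).
Qed.

(** Weak duality: evaluating the supremum [G_f] at a violating [xi] and discarding
    [eta i t * f t x xi <= 0] gives [1 - s i <= lam * nrm (xi - zeta i)]. So [s i] dominates the
    positive part in the Wasserstein bound. *)
Lemma Z_reform_sub (R : realType) (n m Tn N : nat)
    (nrm : 'rV[R]_m -> R) (Xi : set 'rV[R]_m)
    (f : 'I_Tn -> 'rV[R]_n -> 'rV[R]_m -> R)
    (zeta : 'I_N -> 'rV[R]_m) (delta eps : R) :
  (0 < N)%N -> 0 <= eps -> is_norm nrm -> closed Xi ->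
  (forall t x, {within Xi, continuous (f t x)}) ->
  Z_reform nrm Xi f zeta delta eps `<=` Z_D nrm Xi f zeta delta eps.
Proof.
move=> N0 eps0 hn cXi cf x [lam [s [z [eta [lam0 s0 hsum hcon]]]]].
apply: le_ereal_inf_tmp => _ [P [PXi [_ PW]] <-].
set S := [set xi : Borel_rV R m | _].
have mXi : measurable (Xi : set (Borel_rV R m)) by exact: closed_measurable_rV.
have mS : measurable S.
  apply: (@closed_measurable_rV R m); exact: (closed_superlevel cXi (fun t => cf t x)).
have SXi : S `<=` Xi by move=> xi [].
pose B := unsafe_set Xi f x.
have mB : measurable (B : set (Borel_rV R m)).
  by rewrite /B unsafe_setE; exact: measurableD.
have PSB : (P S + P B = 1)%E.
  rewrite -PXi -measureU//; last first.
    by rewrite /B unsafe_setE setDIK.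
  by congr (P _); rewrite /B unsafe_setE setDUK.
have PBle : (P B <= eps%:E)%E.
  have [B0|/set0P B0] := eqVneq B set0; first by rewrite B0 measure0 lee_fin.
  apply: le_trans (wasserstein_ball_bound hn N0 lam0 B0 mB PW) _.
  rewrite lee_fin; apply: le_trans hsum; rewrite lerD2l.
  rewrite ler_pM2l ?invr_gt0 ?ltr0n//; apply: ler_sum => i _.
  rewrite ge_max s0/=.
  have sB xi : B xi -> 1 - s i <= lam * nrm (xi - zeta i).
    move=> [Xxi [t ft]].
    have [eta0 hG] := hcon i t (ex_intro2 _ _ xi Xxi ft).
    rewrite subr_le0 => /(dual_norm_le _ hn lam0) hz.
    have GE : ((dotv (z i t) xi - eta i t * f t x xi)%:E <=
        G_f Xi (f t) (z i t) (eta i t) x)%E.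
      by apply: ereal_sup_ubound; exists xi.
    have := le_trans (leeD2r _ GE) hG; rewrite -EFinD lee_fin.
    have := hz (zeta i - xi); rewrite dotvBr (is_normB _ _ hn).
    have : 0 <= eta i t * - f t x xi by apply: mulr_ge0 => //; lra.
    lra.
  (* To pass to the infimum one divides by [lam]; if [lam = 0], a single violating point already
     gives [1 <= s i]. *)
  have [lam00|lam00] := eqVneq lam 0.
    by have [b /sB] := B0; rewrite lam00 !mul0r; lra.
  have {}lam00 : 0 < lam by rewrite lt_def lam00.
  suff : (1 - s i) / lam <= nrm_dist nrm B (zeta i).
    by rewrite ler_pdivrMr//; lra.
  apply: le_nrm_dist => // xi /sB.
  by rewrite ler_pdivrMr// mulrC.
have PSf : P S \is a fin_num by exact: fin_num_measure.
have PBf : P B \is a fin_num by exact: fin_num_measure.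
move: PSB PBle; rewrite -(fineK PSf) -(fineK PBf) -EFinD !lee_fin => -[].
by lra.
Qed.

(** Strong duality: each plan [p] within budget yields a distribution in the ball, and membership in
    [Z_D] caps its moved mass by [N%:R * eps]. Knapsack duality supplies [lam], and the norm
    constraint duality supplies [z] and [eta]. *)
Lemma sub_Z_reform (R : realType) (n m Tn N : nat)
    (nrm : 'rV[R]_m -> R) (Xi : set 'rV[R]_m)
    (f : 'I_Tn -> 'rV[R]_n -> 'rV[R]_m -> R)
    (zeta : 'I_N -> 'rV[R]_m) (delta eps : R) :
  (0 < N)%N -> 0 <= eps -> 0 < delta -> is_norm nrm -> convex_set_rV Xi ->
  (forall t x, convex_on_rV Xi (f t x)) -> (forall i, Xi (zeta i)) ->
  Z_D nrm Xi f zeta delta eps `<=` Z_reform nrm Xi f zeta delta eps.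
Proof.
move=> N0 eps0 delta0 hn cXi cf Xz x xZ.
have NR0 : 0 < N%:R :> R by rewrite ltr0n.
pose B := unsafe_set Xi f x.
(* Without violations [T_of Xi f x] is empty, and zero multipliers suffice. *)
have [B0|/set0P B0] := eqVneq B set0.
  exists 0, (fun=> 0), (fun _ _ => 0), (fun _ _ => 0); split=> //.
    by rewrite mul0r add0r big1// mulr0.
  move=> i t [xi Xxi ft].
  by have : B xi by [split=> //; exists t]; rewrite B0.
pose d i := nrm_dist nrm B (zeta i).
have d0 i : 0 <= d i by exact: nrm_dist_ge0.
have Nd0 : 0 < N%:R * delta by exact: mulr_gt0.
have [|lam lam0 hlam] := knapsack_duality (c := N%:R * eps) Nd0 d0.
  move=> p p01 pd.
  pose e := (N%:R * delta - \sum_i p i * d i) / N%:R.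
  have e0 : 0 < e by apply: divr_gt0 => //; lra.
  have near_B i : exists xi, B xi /\ nrm (xi - zeta i) <= d i + e.
    apply: contrapT => /forallNP h.
    suff : d i + e <= d i by lra.
    apply: le_nrm_dist => // xi Bxi; rewrite leNgt; apply/negP => lt.
    by apply: (h xi); split=> //; exact: ltW.
  have [xi hxi] := choice near_B.
  have [P PA PE] : exists2 P, ambiguity_set nrm Xi zeta delta P &
      forall A, P A = (N%:R^-1 *
        \sum_i ((1 - p i) * \1_A (zeta i) + p i * \1_A (xi i)))%:E.
    apply: transport_ambiguity => // [i|]; first by have [[]] := hxi i.
    apply: (@le_trans _ _ (\sum_i (p i * d i + e))).
      apply: ler_sum => i _; have [_ hi] := hxi i.
      have /andP[pi0 pi1] := p01 i.
      have := ler_wpM2l pi0 hi; have : p i * e <= e by rewrite ler_piMl// ltW.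
      by lra.
    rewrite big_split/= sumr_const card_ord -[e *+ N]mulr_natr /e.
    by rewrite divfK ?gt_eqF//; lra.
  have := le_trans xZ (ereal_inf_lbound (ex_intro2 _ _ P PA erefl)).
  rewrite PE lee_fin mulrC ler_pdivlMr// => h.
  (* Moved mass lies in [B], so the safe event receives at most the mass that stays. *)
  suff h2 : \sum_i ((1 - p i) * \1_([set xi0 | Xi xi0 /\ (forall t, 0 <= f t x xi0)]) (zeta i)
     + p i * \1_([set xi0 | Xi xi0 /\ (forall t, 0 <= f t x xi0)]) (xi i)) <=
     \sum_(i < N) (1 - p i).
    have := le_trans h h2; rewrite sumrB sumr_const card_ord; lra.
  apply: ler_sum => i _; have /andP[pi0 pi1] := p01 i.
  have [Bxi _] := hxi i.
  rewrite !indicE [xi i \in _]memNset; last first.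
    by move=> -[_ h']; case: Bxi => _ [t]; rewrite ltNge h'.
  by rewrite mulr0 addr0 ler_piMr ?subr_ge0//; case: (_ \in _).
pose s i := Num.max 0 (1 - lam * d i).
(* The implication sits inside the existential, with the dummy pair [(0, 0)] off [T_of Xi f x], so
   that [choice] gives total functions of [(i, t)]. *)
have dual i t : exists ze : 'rV[R]_m * R, T_of Xi f x t ->
    [/\ 0 <= ze.2, forall v, dotv ze.1 v <= lam * nrm v &
    forall xi, Xi xi -> dotv ze.1 xi - ze.2 * f t x xi <=
      dotv ze.1 (zeta i) - (1 - s i)].
  have [Tt|nTt] := pselect (T_of Xi f x t); last by exists (0, 0).
  have [||z [eta h]] := norm_constraint_duality
    (w := zeta i) (c := 1 - s i) hn lam0 cXi (cf t x).
  - exact: Tt.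
  - move=> xi Xxi ft.
    have Bxi : B xi by split=> //; exists t.
    have := ler_wpM2l lam0 (nrm_dist_le (zeta i) hn Bxi).
    have : 1 - lam * d i <= s i by rewrite /s le_max lexx orbT.
    by rewrite /d; lra.
  - by exists (z, eta).
have [ze hz] := choice (fun k : 'I_N * 'I_Tn => dual k.1 k.2).
exists lam, s, (fun i t => (ze (i, t)).1), (fun i t => (ze (i, t)).2); split => //.
- by move=> i; rewrite /s le_max lexx.
- by rewrite -(ler_pM2l NR0) mulrDr mulVKf ?gt_eqF// mulrCA.
- move=> i t Tt; have [eta0 zn hG] := hz (i, t) Tt; split => //.
    have : (G_f Xi (f t) (ze (i, t)).1 (ze (i, t)).2 x <=
        (dotv (ze (i, t)).1 (zeta i) - (1 - s i))%:E)%E.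
      by apply: ge_ereal_sup => _ [xi Xxi <-]; rewrite lee_fin; exact: hG.
    move=> /(leeD2r (1 - dotv (ze (i, t)).1 (zeta i) - s i)%:E) /le_trans; apply.
    by rewrite -EFinD lee_fin; lra.
  by rewrite subr_le0; apply/dual_norm_le.
Qed.

Theorem theorem1 (R : realType) (n m Tn N : nat)
    (nrm : 'rV[R]_m -> R) (Xi : set 'rV[R]_m)
    (f : 'I_Tn -> 'rV[R]_n -> 'rV[R]_m -> R)
    (zeta : 'I_N -> 'rV[R]_m) (delta eps : R) :
  (0 < Tn)%N -> (0 < N)%N ->
  0 < eps < 1 -> 0 < delta ->
  is_norm nrm ->
  (* (A2) *)
  Xi !=set0 -> closed Xi -> convex_set_rV Xi ->
  (* (A1) *)
  (forall t x, convex_on_rV Xi (f t x)) ->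
  (forall t x, {within Xi, continuous (f t x)}) ->
  (forall t xi, Xi xi -> concave_rV (fun x => f t x xi)) ->
  (forall t xi, Xi xi -> continuous (fun x => f t x xi)) ->
  (forall i, Xi (zeta i)) ->
  Z_D nrm Xi f zeta delta eps = Z_reform nrm Xi f zeta delta eps.
Proof.
move=> _ N0 /andP[eps0 _] delta0 hn _ clXi cvXi cvf cf _ _ Xz.
apply/seteqP; split.
  exact: (sub_Z_reform N0 (ltW eps0) delta0 hn cvXi cvf Xz).
exact: (Z_reform_sub N0 (ltW eps0) hn clXi cf).
Qed.
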